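(* Let $A\in\mathbb{R}^{m\times n}$ with $m\ge 2$ have pairwise linearly independent rows $a_1^\top,\dots,a_m^\top$, and let $b\in\mathbb{R}^m$ be such that $Ax=b$ is consistent. Let $\{x^{(k)}\}$ be generated by the GMIRK method with selected indices $i_0,i_1,\dots$. For every $k\ge1$ for which $x^{(k+1)}$ is generated, let $$d^{(k)}=a_{i_k}-\frac{\langle a_{i_k},a_{i_{k-1}}\rangle}{\|a_{i_{k-1}}\|_2^2}a_{i_{k-1}},$$ and let $\eta_k\in\mathbb{R}$ be such that $x^{(k)}+\eta_kd^{(k)}$ lies on the hyperplane $H_{i_k}=\{x\in\mathbb{R}^n : \langle a_{i_k},x\rangle=b_{i_k}\}$. Then the oblique projection step from $x^{(k)}$ yields the same point as the multi-step inertial step, i.e. $$x^{(k)}+\eta_kd^{(k)}=x^{(k+1)}.$$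
   Context: Notation: $[m]=\{1,\dots,m\}$; $a_i\in\mathbb{R}^n$ is the transpose of the $i$-th row of $A$ and $b_i$ the $i$-th entry of $b$; $\|A\|_F$ is the Frobenius norm. For $i\ne j$ the vectors $a_i,a_j$ are assumed linearly independent. Define (empty sums being $0$) $$\gamma_1=\max_{i\in[m]}\sum_{j\ne i}\|a_j\|_2^2,\qquad \gamma_2=\max_{i,j\in[m],\,i\ne j}\ \sum_{k\ne i,j}\|a_k\|_2^2 .$$ GMIRK method (greedy multi-step inertial randomized Kaczmarz). Put $\Gamma_0=\|A\|_F^2$, $\Gamma_1=\gamma_1$, and $\Gamma_k=\gamma_2$ for $k\ge2$. Starting from an arbitrary $x^{(0)}\in\mathbb{R}^n$, for $k=0,1,2,\dots$: if $Ax^{(k)}=b$, terminate (no further iterates or indices are generated). Otherwise: (1) compute $\varepsilon_k=\frac12\left(\frac{1}{\|Ax^{(k)}-b\|_2^2}\max_{i\in[m]}\frac{|a_i^\top x^{(k)}-b_i|^2}{\|a_i\|_2^2}+\frac{1}{\Gamma_k}\right)$; (2) set $\mathcal{I}_k=\{i\in[m] : |a_i^\top x^{(k)}-b_i|^2\ge \varepsilon_k\|Ax^{(k)}-b\|_2^2\|a_i\|_2^2\}$; (3) select an index $i_k\in\mathcal{I}_k$ with $\mathrm{Prob}(i_k=i)=p_i^{(k)}$, where $p_i^{(k)}=0$ for $i\notin\mathcal{I}_k$, $p_i^{(k)}\ge0$ for $i\in\mathcal{I}_k$ and $\sum_{i\in\mathcal{I}_k}p_i^{(k)}=1$ (the probabilities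 are otherwise arbitrary; the selected index always lies in $\mathcal{I}_k$); (4) if $k=0$ set $w^{(0)}=x^{(0)}$; if $k\ge1$ set $$\beta_k=\frac{\langle a_{i_k},a_{i_{k-1}}\rangle\,(\langle a_{i_k},x^{(k)}\rangle-b_{i_k})}{\|a_{i_k}\|_2^2\|a_{i_{k-1}}\|_2^2-\langle a_{i_k},a_{i_{k-1}}\rangle^2},\qquad w^{(k)}=x^{(k)}+\beta_k a_{i_{k-1}};$$ (5) set $x^{(k+1)}=w^{(k)}-\frac{\langle a_{i_k},w^{(k)}\rangle-b_{i_k}}{\|a_{i_k}\|_2^2}a_{i_k}$. *)

(* Defs.v *)
From HB Require Import structures.
From mathcomp Require Import all_boot all_order all_algebra.
From mathcomp Require Import all_classical all_reals all_analysis.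

Set Implicit Arguments.
Unset Strict Implicit.
Unset Printing Implicit Defensive.

Import Order.TTheory GRing.Theory Num.Theory.

Local Open Scope ring_scope.

(* The norm `|v| that the library puts on matrices is the maximum norm, hence
   the Euclidean and Frobenius norms below. *)

Definition dotp (R : realType) (n : nat) (u v : 'cV[R]_n) : R :=
  \sum_(j < n) u j 0 * v j 0.

Definition norm2 (R : realType) (n : nat) (u : 'cV[R]_n) : R :=
  Num.sqrt (dotp u u).

Definition normF (R : realType) (m n : nat) (A : 'M[R]_(m, n)) : R :=
  Num.sqrt (\sum_(i < m) \sum_(j < n) A i j ^+ 2).

Definition arow (R : realType) (m n : nat) (A : 'M[R]_(m, n)) (i : 'I_m) :
  'cV[R]_n := (row i A)^T.

Definition pairwise_free_rows (R : realType) (m n : nat) (A : 'M[R]_(m, n)) :=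
  forall i j : 'I_m, i != j -> free [:: arow A i; arow A j].

Definition consistent (R : realType) (m n : nat) (A : 'M[R]_(m, n))
  (b : 'cV[R]_m) := exists x : 'cV[R]_n, A *m x = b.

Definition hyperplane (R : realType) (m n : nat) (A : 'M[R]_(m, n))
    (b : 'cV[R]_m) (i : 'I_m) : set 'cV[R]_n :=
  [set x | dotp (arow A i) x = b i 0]%classic.

(* All maxima below are of nonnegative quantities, so the default value 0 of
   the iterated maximum is harmless as soon as the index range is nonempty. *)

Definition gamma1 (R : realType) (m n : nat) (A : 'M[R]_(m, n)) : R :=
  \big[Num.max/0]_(i < m) \sum_(j < m | j != i) norm2 (arow A j) ^+ 2.

Definition gamma2 (R : realType) (m n : nat) (A : 'M[R]_(m, n)) : R :=
  \big[Num.max/0]_(i < m) \big[Num.max/0]_(j < m | j != i)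
    \sum_(k < m | (k != i) && (k != j)) norm2 (arow A k) ^+ 2.

Definition Gamma (R : realType) (m n : nat) (A : 'M[R]_(m, n)) (k : nat) : R :=
  match k with
  | 0 => normF A ^+ 2
  | 1 => gamma1 A
  | _ => gamma2 A
  end.

(* For m = 2 one has Gamma A k = 0 when k >= 2, and the library's convention
   is 0^-1 = 0; but then x^(2) already solves the system, so that epsilon is
   only ever used with a positive Gamma A k. *)
Definition epsilon (R : realType) (m n : nat) (A : 'M[R]_(m, n))
    (b : 'cV[R]_m) (k : nat) (x : 'cV[R]_n) : R :=
  1 / 2 *
  (1 / norm2 (A *m x - b) ^+ 2 *
     \big[Num.max/0]_(i < m)
        (`|dotp (arow A i) x - b i 0| ^+ 2 / norm2 (arow A i) ^+ 2)
   + 1 / Gamma A k).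

Definition greedy_set (R : realType) (m n : nat) (A : 'M[R]_(m, n))
    (b : 'cV[R]_m) (k : nat) (x : 'cV[R]_n) : {set 'I_m} :=
  [set i : 'I_m | epsilon A b k x * norm2 (A *m x - b) ^+ 2
                    * norm2 (arow A i) ^+ 2
                  <= `|dotp (arow A i) x - b i 0| ^+ 2]%SET.

(* Inertial coefficient at the point x, for the current index i and the
   previous index i'. *)
Definition beta (R : realType) (m n : nat) (A : 'M[R]_(m, n)) (b : 'cV[R]_m)
    (x : 'cV[R]_n) (i i' : 'I_m) : R :=
  dotp (arow A i) (arow A i') * (dotp (arow A i) x - b i 0) /
  (norm2 (arow A i) ^+ 2 * norm2 (arow A i') ^+ 2
     - dotp (arow A i) (arow A i') ^+ 2).

Definition inertial_point (R : realType) (m n : nat) (A : 'M[R]_(m, n))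
    (b : 'cV[R]_m) (x : nat -> 'cV[R]_n) (i : nat -> 'I_m) (k : nat) :
    'cV[R]_n :=
  match k with
  | 0 => x 0%N
  | k'.+1 => x k + beta A b (x k) (i k) (i k') *: arow A (i k')
  end.

Definition kaczmarz_step (R : realType) (m n : nat) (A : 'M[R]_(m, n))
    (b : 'cV[R]_m) (w : 'cV[R]_n) (i : 'I_m) : 'cV[R]_n :=
  w - ((dotp (arow A i) w - b i 0) / norm2 (arow A i) ^+ 2) *: arow A i.

(* A trajectory is a pair of total sequences, of which only the terms produced
   before termination are meaningful: x^(k) is generated when none of x^(0),
   ..., x^(k-1) solves the system.  The index i_k is selected exactly when
   x^(k+1) is generated. *)
Definition generated (R : realType) (m n : nat) (A : 'M[R]_(m, n))
    (b : 'cV[R]_m) (x : nat -> 'cV[R]_n) (k : nat) : Prop :=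
  forall j : nat, (j < k)%N -> A *m x j <> b.

Definition selection_probability (R : realType) (m : nat) (I : {set 'I_m})
    (p : 'I_m -> R) : Prop :=
  [/\ forall i, i \notin I -> p i = 0,
      forall i, i \in I -> 0 <= p i
    & \sum_(i in I) p i = 1].

Definition past_event (T : Type) (m : nat) (i : nat -> T -> 'I_m) (k : nat)
    (t0 : T) : set T :=
  [set t | forall j : nat, (j < k)%N -> i j t = i j t0]%classic.

(* The method as a random process on a probability space (T, P): x k t, i k t
   and p k t are the values of x^(k), i_k and p^(k) at the outcome t.  As the
   algorithm only makes Prob(i_k = .) = p^(k) available once x^(k) is known,
   it is read as the law of i_k given the indices selected so far. *)
Record GMIRK (R : realType) (d : measure_display) (T : measurableType d)
    (P : probability T R) (m n : nat) (A : 'M[R]_(m, n)) (b : 'cV[R]_m)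
    (x0 : 'cV[R]_n) (x : nat -> T -> 'cV[R]_n) (i : nat -> T -> 'I_m)
    (p : nat -> T -> 'I_m -> R) : Prop := {
  GMIRK_start : forall t, x 0%N t = x0;
  GMIRK_probability : forall k t, generated A b (x^~ t) k.+1 ->
    selection_probability (greedy_set A b k (x k t)) (p k t);
  GMIRK_select : forall k t, generated A b (x^~ t) k.+1 ->
    i k t \in greedy_set A b k (x k t);
  GMIRK_measurable : forall k j,
    measurable [set t | generated A b (x^~ t) k.+1 /\ i k t = j]%classic;
  GMIRK_law : forall k t0, generated A b (x^~ t0) k.+1 -> forall j,
    P (past_event i k t0 `&` [set t | i k t = j])%classic =
    (P (past_event i k t0) * (p k t0 j)%:E)%E;
  GMIRK_step : forall k t, generated A b (x^~ t) k.+1 ->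
    x k.+1 t = kaczmarz_step A b (inertial_point A b (x^~ t) (i^~ t) k) (i k t)
}.

Definition oblique_direction (R : realType) (m n : nat) (A : 'M[R]_(m, n))
    (i i' : 'I_m) : 'cV[R]_n :=
  arow A i
  - (dotp (arow A i) (arow A i') / norm2 (arow A i') ^+ 2) *: arow A i'.

(* Main.v *)
Require Import Defs.
From mathcomp Require Import all_boot all_order all_algebra.
From mathcomp Require Import all_classical all_reals all_analysis.
From mathcomp Require Import ring.

Import Order.TTheory GRing.Theory Num.Theory.

Local Open Scope ring_scope.

(** Write u, v for the rows selected at steps k and k-1, c for <u, v>, and r
    for the residual <u, x> - b_u at x = x^(k).  The oblique direction
    d = u - (c / |v|^2) v is the component of u orthogonal to v, so
    <u, d> = <d, d> = (|u|^2 |v|^2 - c^2) / |v|^2 ([dotp_oblique]).  When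
    the two rows are independent, d is nonzero, the last expression is positive
    ([gram_neq0]), and membership in the hyperplane has exactly one solution,
    eta = - r |v|^2 / (|u|^2 |v|^2 - c^2).  Expanding the inertial step gives
    the same coefficients along u and v: beta = c r / (|u|^2 |v|^2 - c^2) is
    - eta c / |v|^2, and the projection that follows contributes eta along u.

    If the same row is selected at both steps, then d = 0, so the hypothesis
    says that x^(k) already lies on the hyperplane; its residual vanishes,
    and both steps leave x^(k) unchanged; beta is then 0, as r is a factor of
    its numerator ([inertial_step_hyperplane]). *)

Section Euclidean.
Context {R : realType} {n : nat}.
Implicit Types (u v w : 'cV[R]_n) (a : R).

Lemma dotpC u v : dotp u v = dotp v u.
Proof. by apply: eq_bigr => j _; rewrite mulrC. Qed.

Lemma dotpDr u v w : dotp u (v + w) = dotp u v + dotp u w.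
Proof. by rewrite -big_split; apply: eq_bigr => j _; rewrite mxE mulrDr. Qed.

Lemma dotpZr a u v : dotp u (a *: v) = a * dotp u v.
Proof. by rewrite mulr_sumr; apply: eq_bigr => j _; rewrite mxE mulrCA. Qed.

Lemma dotpNr u v : dotp u (- v) = - dotp u v.
Proof. by rewrite -scaleN1r dotpZr mulN1r. Qed.

Lemma dotpBr u v w : dotp u (v - w) = dotp u v - dotp u w.
Proof. by rewrite dotpDr dotpNr. Qed.

Lemma dotp_ge0 u : 0 <= dotp u u.
Proof. by apply: sumr_ge0 => j _; rewrite -expr2 sqr_ge0. Qed.

Lemma dotp_eq0 u : dotp u u = 0 -> u = 0.
Proof.
move=> /psumr_eq0P u0; apply/colP => j; rewrite mxE; apply/eqP.
by rewrite -sqrf_eq0 expr2 u0 // => l _; rewrite -expr2 sqr_ge0.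
Qed.

Lemma sqr_norm2 u : norm2 u ^+ 2 = dotp u u.
Proof. by rewrite sqr_sqrtr // dotp_ge0. Qed.

Lemma free_pairP u v :
  free [:: u; v] -> v != 0 /\ forall a, u - a *: v != 0.
Proof.
rewrite free_cons seq1_free span_seq1 => /andP[uNv v0]; split=> // a.
apply: contraNneq uNv => /subr0_eq ->; apply/vlineP.
by exists a.
Qed.

(** Both products equal the squared length of the component of u orthogonal
    to v. *)
Lemma dotp_oblique u v (d := u - (dotp u v / dotp v v) *: v) :
  v != 0 -> dotp d d = dotp u d.
Proof.
move=> v0; have vv0 : dotp v v != 0 by apply: contraNneq v0 => /dotp_eq0 ->.
have vd0 : dotp v d = 0 by rewrite dotpBr dotpZr divfK // dotpC subrr.
by rewrite {2}/d dotpC dotpBr dotpZr [dotp d v]dotpC vd0 mulr0 subr0 dotpC.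
Qed.

(** The equality case of the Cauchy-Schwarz inequality: up to the factor
    <v, v>, the Gram determinant is the squared length of a nonzero vector. *)
Lemma gram_neq0 u v :
  free [:: u; v] -> dotp u u * dotp v v - dotp u v ^+ 2 != 0.
Proof.
move=> /free_pairP[v0 /(_ (dotp u v / dotp v v)) d0].
have vv0 : dotp v v != 0 by apply: contraNneq v0 => /dotp_eq0 ->.
apply: contraNneq d0 => gram0; apply/eqP/dotp_eq0.
rewrite dotp_oblique // dotpBr dotpZr; apply: (mulIf vv0).
by rewrite mul0r -gram0; field.
Qed.

End Euclidean.

Section Step.
Context {R : realType} {m n : nat} (A : 'M[R]_(m, n)) (b : 'cV[R]_m).
Implicit Types (x : 'cV[R]_n) (i j : 'I_m).

Lemma oblique_direction_diag i : oblique_direction A i i = 0.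
Proof.
rewrite /oblique_direction sqr_norm2.
have [/dotp_eq0 -> | aa0] := eqVneq (dotp (arow A i) (arow A i)) 0.
  by rewrite scaler0 subr0.
by rewrite divff // scale1r subrr.
Qed.

Lemma inertial_step_hyperplane x i j :
  hyperplane A b i x ->
  kaczmarz_step A b (x + beta A b x i j *: arow A j) i = x.
Proof.
move=> xH; rewrite /beta (xH : dotp _ _ = _) subrr mulr0 mul0r scale0r addr0.
by rewrite /kaczmarz_step xH subrr mul0r scale0r subr0.
Qed.

Lemma oblique_step_free x i j (eta : R) (d := oblique_direction A i j) :
  free [:: arow A i; arow A j] -> hyperplane A b i (x + eta *: d) ->
  x + eta *: d = kaczmarz_step A b (x + beta A b x i j *: arow A j) i.
Proof.
move=> uv_free; have gram0 := gram_neq0 _ _ uv_free.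
have [v0 /(_ 0)] := free_pairP _ _ uv_free; rewrite scale0r subr0 => u0.
rewrite /hyperplane /= /d /oblique_direction /kaczmarz_step /beta !sqr_norm2.
move: (arow A i) (arow A j) u0 v0 gram0 {uv_free d} => u v u0 v0 gram0.
have uu0 : dotp u u != 0 by apply: contraNneq u0 => /dotp_eq0 ->.
have vv0 : dotp v v != 0 by apply: contraNneq v0 => /dotp_eq0 ->.
rewrite !(dotpDr, dotpNr, dotpZr).
move: (dotp u u) (dotp v v) (dotp u v) (dotp u x) uu0 vv0 gram0.
move=> U V c y U0 V0 gram0 <-.
(* Substituting the hyperplane equation for the entry of b turns the residual
   at x into - eta (U - c^2 / V), whose second factor is the nonzero Gram
   determinant over V: it cancels against the denominator of beta. *)
apply/colP => l; rewrite !mxE; field.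
by rewrite U0 V0.
Qed.

End Step.

Theorem mainTheorem3 (R : realType) (d : measure_display)
    (T : measurableType d) (P : probability T R) (m n : nat)
    (A : 'M[R]_(m, n)) (b : 'cV[R]_m) (x0 : 'cV[R]_n)
    (x : nat -> T -> 'cV[R]_n) (i : nat -> T -> 'I_m)
    (p : nat -> T -> 'I_m -> R)
    (hm : (2 <= m)%N) (hA : pairwise_free_rows A) (hb : consistent A b)
    (hx : GMIRK P A b x0 x i p)
    (t : T) (k : nat) (hk : (1 <= k)%N)
    (hgen : generated A b (fun j => x j t) k.+1)
    (eta : R) :
  let dk := oblique_direction A (i k t) (i k.-1 t) in
  hyperplane A b (i k t) (x k t + eta *: dk) ->
  x k t + eta *: dk = x k.+1 t.
Proof.
rewrite (GMIRK_step hx hgen); case: k hk {hgen} => // k _ /=.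
have [<- | ij] := eqVneq (i k.+1 t) (i k t).
  rewrite oblique_direction_diag scaler0 addr0 => xH.
  by rewrite inertial_step_hyperplane.
exact: oblique_step_free (hA _ _ ij).
Qed.
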